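(* Let $\mu(t)\in\mathcal{H}_{q,n}$ be a solution to the bracket flow $\frac{d}{dt}\mu=-\pi\left(\begin{bmatrix}0&0\\0&\mathrm{Ric}_\mu\end{bmatrix}\right)\mu$, $\mu(0)=\mu_0\in\mathcal{H}_{q,n}$. Write $\mathrm{Ric}=\mathrm{Ric}_{\mu(t)}$, $\mathrm{M}=\mathrm{M}_{\mu_{\mathfrak{p}}(t)}$, $B=B_{\mu(t)}$, $H=H_{\mu_{\mathfrak{p}}(t)}$, $U=S(\mathrm{ad}_{\mu_{\mathfrak{p}}(t)}H)$, $R=\mathrm{tr}\,\mathrm{Ric}$, $\Delta=\Delta_{\mu_{\mathfrak{p}}(t)}$. Then the following evolution equations hold: (i) $\frac{d}{dt}\mathrm{Ric}=-\frac12\Delta(\mathrm{Ric})-\frac12(B\,\mathrm{Ric}+\mathrm{Ric}\,B)-2S(\mathrm{ad}_{\mu_{\mathfrak{p}}}\mathrm{Ric}(H))-S([\mathrm{ad}_{\mu_{\mathfrak{p}}}H,\mathrm{Ric}])$. (ii) $\frac{d}{dt}\mathrm{M}=-\frac12\Delta(\mathrm{Ric})$. (iii) $\frac{d}{dt}B=B\,\mathrm{Ric}+\mathrm{Ric}\,B$. (iv) $\frac{d}{dt}H=\mathrm{Ric}(H)$. (v) $\frac{d}{dt}U=2S(\mathrm{ad}_{\mu_{\mathfrak{p}}}\mathrm{Ric}(H))+S([\mathrm{ad}_{\mu_{\mathfrak{p}}}H,\mathrm{Ric}])$. (vi) $\frac{d}{dt}R=2\,\mathrm{tr}\,\mathrm{Ric}^2=2\|\mathrm{Ric}\|^2$.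 (vii) $\frac{d}{dt}\|\mu_{\mathfrak{p}}\|^2=-8\,\mathrm{tr}(\mathrm{Ric}\,\mathrm{M})$. (viii) $\frac{d}{dt}\mathrm{tr}\,B=2\,\mathrm{tr}(\mathrm{Ric}\,B)$. (ix) $\frac{d}{dt}\|H\|^2=-2\,\mathrm{tr}\big(S(\mathrm{ad}_{\mu_{\mathfrak{p}}}H)^2\big)$.
   Context: Fix a real vector space $\mathfrak{g}=\mathfrak{k}\oplus\mathfrak{p}$ with $\dim\mathfrak{k}=q$, $\dim\mathfrak{p}=n$, and an inner product $\langle\cdot,\cdot\rangle$ on $\mathfrak{p}$ with orthonormal basis $\{X_1,\dots,X_n\}$. $V_{q+n}$ (resp. $V_n$) is the space of skew-symmetric bilinear maps $\mathfrak{g}\times\mathfrak{g}\to\mathfrak{g}$ (resp. $\mathfrak{p}\times\mathfrak{p}\to\mathfrak{p}$); $\mathrm{ad}_\mu X(Y)=\mu(X,Y)$; $\pi(A)\mu=A\mu(\cdot,\cdot)-\mu(A\cdot,\cdot)-\mu(\cdot,A\cdot)$, both for $A\in\mathfrak{gl}(\mathfrak{g})$, $\mu\in V_{q+n}$ and for $A\in\mathfrak{gl}(\mathfrak{p})=\mathfrak{gl}_n(\mathbb{R})$, $\mu\in V_n$. $\mathcal{H}_{q,n}\subset V_{q+n}$ is the set of $\mu$ such that: (h1) $\mu$ satisfies the Jacobi identity, $\mu(\mathfrak{k},\mathfrak{k})\subset\mathfrak{k}$ and $\mu(\mathfrak{k},\mathfrak{p})\subset\mathfrak{p}$; (h2)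 if $G_\mu$ is the simply connected Lie group with Lie algebra $(\mathfrak{g},\mu)$ and $K_\mu$ is the connected Lie subgroup with Lie algebra $\mathfrak{k}$, then $K_\mu$ is closed in $G_\mu$; (h3) $\mathrm{ad}_\mu Z|_{\mathfrak{p}}$ is skew-symmetric for all $Z\in\mathfrak{k}$; (h4) $\{Z\in\mathfrak{k}:\mu(Z,\mathfrak{p})=0\}=0$. Such a $\mu$ corresponds to the homogeneous space $(G_\mu/K_\mu,g_\mu)$, where $g_\mu$ is the $G_\mu$-invariant metric equal to $\langle\cdot,\cdot\rangle$ at the origin. The bracket flow preserves $\mathcal{H}_{q,n}$. For $\mu\in\mathcal{H}_{q,n}$, $\mu_{\mathfrak{p}}\in V_n$ is the $\mathfrak{p}$-component of $\mu|_{\mathfrak{p}\times\mathfrak{p}}$. $S(A)=\frac12(A+A^t)$ for $A\in\mathfrak{gl}_n(\mathbb{R})$. $B_\mu:\mathfrak{p}\to\mathfrak{p}$ is given by $\langle B_\mu X,Y\rangle=\mathrm{tr}(\mathrm{ad}_\mu X\,\mathrm{ad}_\mu Y)$ (trace over $\mathfrak{g}$), $X,Y\in\mathfrak{p}$. For $\lambda\in V_n$: $H_\lambda\in\mathfrak{p}$ is given by $\langle H_\lambda,X\rangle=\mathrm{tr}\,\mathrm{ad}_\lambda X$, and $\mathrm{M}_\lambda:\mathfrak{p}\to\mathfrak{p}$ by $\langle\mathrm{M}_\lambda X,Y\rangle=-\frac12\sum_{i,j}\langle\lambda(X,X_i),X_j\rangle\langle\lambda(Y,X_i),X_j\rangle+\frac14\sum_{i,j}\langle\lambda(X_i,X_j),X\rangle\langle\lambda(X_i,X_j),Y\rangle$.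 The Ricci operator of $(G_\mu/K_\mu,g_\mu)$ is $\mathrm{Ric}_\mu=\mathrm{M}_{\mu_{\mathfrak{p}}}-\frac12B_\mu-S(\mathrm{ad}_{\mu_{\mathfrak{p}}}H_{\mu_{\mathfrak{p}}})$. The inner product on $V_n$ is $\langle\mu,\lambda\rangle=\sum_{i,j}\langle\mu(X_i,X_j),\lambda(X_i,X_j)\rangle$ and on $\mathfrak{gl}_n(\mathbb{R})$ it is $\langle A,C\rangle=\mathrm{tr}(AC^t)$. For $\lambda\in V_n$, $\delta_\lambda:\mathfrak{gl}_n(\mathbb{R})\to V_n$ is $\delta_\lambda(E)=-\pi(E)\lambda$, $\delta_\lambda^t$ is its transpose, and $\Delta_\lambda:=S\circ\delta_\lambda^t\delta_\lambda:\mathfrak{gl}_n(\mathbb{R})\to\mathfrak{gl}_n(\mathbb{R})$. *)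

(* Defs.v *)
From HB Require Import structures.
From mathcomp Require Import all_boot all_order all_algebra.
From mathcomp Require Import ring.
From mathcomp Require Import all_classical all_reals all_analysis.
Set Implicit Arguments.
Unset Strict Implicit.
Unset Printing Implicit Defensive.
Import Order.TTheory GRing.Theory Num.Theory.
Import numFieldNormedType.Exports.
Local Open Scope classical_set_scope.
Local Open Scope ring_scope.

(* Vectors are columns.  The decomposition g = k + p is R^(q+n) = R^q + R^n,
   and the fixed orthonormal basis X_1, ..., X_n of p is the standard basis of
   R^n, so that gl(p) is 'M[R]_n acting on the left. *)

Section Brackets.
Variable R : realType.

Definition bracket (m : nat) := 'cV[R]_m -> 'cV[R]_m -> 'cV[R]_m.

Definition stdb {m : nat} (i : 'I_m) : 'cV[R]_m := delta_mx i 0.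

Definition skew_bilinear (m : nat) (mu : bracket m) : Prop :=
  [/\ forall X, linear (mu X), forall Y, linear (mu^~ Y)
    & forall X Y, mu X Y = - mu Y X].

Definition ad (m : nat) (mu : bracket m) (X : 'cV[R]_m) : 'M[R]_m :=
  \matrix_(i, j) mu X (stdb j) i 0.

Definition piact (m : nat) (A : 'M[R]_m) (mu : bracket m) : bracket m :=
  fun X Y => A *m mu X Y - mu (A *m X) Y - mu X (A *m Y).

Definition jacobi (m : nat) (mu : bracket m) : Prop :=
  forall X Y Z, mu X (mu Y Z) + mu Y (mu Z X) + mu Z (mu X Y) = 0.

Definition dotv (m : nat) (X Y : 'cV[R]_m) : R := \sum_i X i 0 * Y i 0.

Definition dotV (m : nat) (mu la : bracket m) : R :=
  \sum_i \sum_j dotv (mu (stdb i) (stdb j)) (la (stdb i) (stdb j)).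

Definition dotM (m : nat) (A C : 'M[R]_m) : R := \tr (A *m C^T).

Definition symp (m : nat) (A : 'M[R]_m) : 'M[R]_m := 2^-1 *: (A + A^T).

Definition delta (m : nat) (la : bracket m) (E : 'M[R]_m) : bracket m :=
  fun X Y => - piact E la X Y.

(* The entries are the coordinates of the transpose in the orthonormal basis
   of matrix units; see [dotM_deltaT]. *)
Definition deltaT (m : nat) (la nu : bracket m) : 'M[R]_m :=
  \matrix_(i, j) dotV nu (delta la (delta_mx i j)).

Definition Delta (m : nat) (la : bracket m) (E : 'M[R]_m) : 'M[R]_m :=
  symp (deltaT la (delta la E)).

Definition Hvec (m : nat) (la : bracket m) : 'cV[R]_m :=
  \col_i \tr (ad la (stdb i)).

Definition Mform (m : nat) (la : bracket m) (X Y : 'cV[R]_m) : R :=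
  - 2^-1 * (\sum_i \sum_j dotv (la X (stdb i)) (stdb j)
                        * dotv (la Y (stdb i)) (stdb j))
  + 4^-1 * (\sum_i \sum_j dotv (la (stdb i) (stdb j)) X
                        * dotv (la (stdb i) (stdb j)) Y).

(* Entry (i, j) of the matrix of an operator A is <A X_j, X_i>; the same
   convention is used in [Bop]. See [MopP], [BopP] and [HvecP]. *)
Definition Mop (m : nat) (la : bracket m) : 'M[R]_m :=
  \matrix_(i, j) Mform la (stdb j) (stdb i).

End Brackets.

Section Splitting.
Variables (R : realType) (q n : nat).
Implicit Types mu : bracket R (q + n).

Definition ink (Z : 'cV[R]_q) : 'cV[R]_(q + n) := col_mx Z 0.
Definition inp (X : 'cV[R]_n) : 'cV[R]_(q + n) := col_mx 0 X.

Definition prk (X : 'cV[R]_(q + n)) : 'cV[R]_q := usubmx X.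
Definition prp (X : 'cV[R]_(q + n)) : 'cV[R]_n := dsubmx X.

Definition mu_p mu : bracket R n := fun X Y => prp (mu (inp X) (inp Y)).

Definition Bop mu : 'M[R]_n :=
  \matrix_(i, j) \tr (ad mu (inp (stdb R j)) *m ad mu (inp (stdb R i))).

Definition Ric mu : 'M[R]_n :=
  Mop (mu_p mu) - 2^-1 *: Bop mu - symp (ad (mu_p mu) (Hvec (mu_p mu))).

Definition ext0 (A : 'M[R]_n) : 'M[R]_(q + n) := block_mx 0 0 0 A.

End Splitting.

Section Smooth.
Variable R : realType.

(* Meant for finite-dimensional [V] and open [U]: f is C^k on U iff all its
   iterated directional derivatives up to order k exist and are continuous. *)
Fixpoint Ck (V W : normedModType R) (k : nat) (U : set V) (f : V -> W) : Prop :=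
  {in U, continuous f} /\
  if k is k'.+1 then
    forall v, (forall x, U x -> derivable f x v) /\ Ck k' U (fun x => 'D_v f x)
  else True.

Definition smooth (V W : normedModType R) (U : set V) (f : V -> W) : Prop :=
  forall k, Ck k U f.

Record chart (m : nat) (T : Type) := Chart {
  cdom : set T;
  cmap : T -> 'cV[R]_m;
  cinv : 'cV[R]_m -> T }.

Definition ccod (m : nat) (T : Type) (c : chart m T) : set 'cV[R]_m :=
  cmap c @` cdom c.

Definition chart_homeo (m : nat) (T : topologicalType) (c : chart m T) : Prop :=
  [/\ open (cdom c), open (ccod c),
      forall x, cdom c x -> cinv c (cmap c x) = x,
      {in cdom c, continuous (cmap c)} & {in ccod c, continuous (cinv c)}].

Definition smooth_map (m m' : nat) (T T' : topologicalType)
    (A : set (chart m T)) (A' : set (chart m' T')) (f : T -> T') : Prop :=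
  continuous f /\
  forall c c', A c -> A' c' ->
    smooth (ccod c `&` [set x | cdom c' (f (cinv c x))])
           (fun x => cmap c' (f (cinv c x))).

(* The last clause is the smooth compatibility of the charts. *)
Definition smooth_atlas (m : nat) (T : topologicalType)
    (A : set (chart m T)) : Prop :=
  [/\ forall c, A c -> chart_homeo c,
      forall x, exists2 c, A c & cdom c x
    & smooth_map A A (@id T)].

End Smooth.

HB.structure Definition TopGroup := {G of Group G & Topological G}.
Notation topGroupType := TopGroup.type.

Section LieGroups.
Variable R : realType.

Definition lie_group (m : nat) (G : topGroupType) (A : set (chart R m G))
    : Prop :=
  [/\ hausdorff_space G /\ @second_countable G,
      smooth_atlas A,
      continuous (fun x : G * G => (x.1 * x.2)%g),
      (forall c1 c2 c3, A c1 -> A c2 -> A c3 ->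
         smooth
           [set x : 'cV[R]_m * 'cV[R]_m | [/\ ccod c1 x.1, ccod c2 x.2
              & cdom c3 (cinv c1 x.1 * cinv c2 x.2)%g]]
           (fun x => cmap c3 (cinv c1 x.1 * cinv c2 x.2)%g))
    & smooth_map A A (fun x : G => x^-1%g)].

(* The coordinate expression, in a chart c around 1, of the left-invariant
   vector field whose value at 1 is X. *)
Definition left_invariant_field (m : nat) (G : topGroupType) (c : chart R m G)
    (X : 'cV[R]_m) : 'cV[R]_m -> 'cV[R]_m :=
  fun x => 'D_X (fun y => cmap c (cinv c x * cinv c y)%g) (cmap c 1%g).

(* The value at 1 of the commutator of left-invariant vector fields. *)
Definition lie_bracket (m : nat) (G : topGroupType) (c : chart R m G)
    : bracket R m :=
  fun X Y => 'D_X (left_invariant_field c Y) (cmap c 1%g)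
           - 'D_Y (left_invariant_field c X) (cmap c 1%g).

(* The differential at 1 of the chart c identifies the Lie algebra of G with
   (R^m, mu). *)
Definition lie_algebra_chart (m : nat) (G : topGroupType)
    (A : set (chart R m G)) (mu : bracket R m) (c : chart R m G) : Prop :=
  [/\ A c, cdom c 1%g & forall X Y, lie_bracket c X Y = mu X Y].

Definition path_in (T : topologicalType) (x y : T) (g : R -> T) : Prop :=
  [/\ {within `[0, 1], continuous g}, g 0 = x & g 1 = y].

Definition simply_connected (T : topologicalType) : Prop :=
  (forall x y : T, exists g, path_in x y g) /\
  forall (x : T) (g : R -> T), path_in x x g ->
    exists F : R * R -> T,
      [/\ {within `[0, 1] `*` `[0, 1], continuous F},
          forall s : R, s \in `[0, 1] -> F (0, s) = g s,
          forall s : R, s \in `[0, 1] -> F (1, s) = x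
        & forall t : R, t \in `[0, 1] -> F (t, 0) = x /\ F (t, 1) = x].

(* The pair (K, iota) is the connected Lie subgroup of G whose Lie algebra is
   the subspace k of T_1 G, the latter being read in the chart c. *)
Definition connected_lie_subgroup (m q : nat) (G : topGroupType)
    (A : set (chart R m G)) (c : chart R m G) (k : set 'cV[R]_m)
    (K : topGroupType) (B : set (chart R q K)) (iota : K -> G) : Prop :=
  [/\ lie_group B /\ connected [set: K],
      injective iota, {morph iota : x y / (x * y)%g},
      smooth_map B A iota
    & exists d : chart R q K, [/\ B d, cdom d 1%g,
        injective (fun Z : 'cV[R]_q =>
          'D_Z (fun z => cmap c (iota (cinv d z))) (cmap d 1%g))
      & range (fun Z : 'cV[R]_q =>
          'D_Z (fun z => cmap c (iota (cinv d z))) (cmap d 1%g)) = k]].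

End LieGroups.

Section Hspace.
Variables (R : realType) (q n : nat).
Implicit Types mu : bracket R (q + n).

Definition h1 mu : Prop :=
  [/\ jacobi mu,
      forall Z W : 'cV[R]_q, prp (mu (ink n Z) (ink n W)) = 0
    & forall (Z : 'cV[R]_q) (X : 'cV[R]_n), prk (mu (ink n Z) (inp q X)) = 0].

(* By Lie's theorems G_mu and K_mu exist and are unique up to isomorphism, so
   it does not matter that they are quantified existentially. *)
Definition h2 mu : Prop :=
  exists (G : topGroupType) (A : set (chart R (q + n) G))
         (c : chart R (q + n) G)
         (K : topGroupType) (B : set (chart R q K)) (iota : K -> G),
    [/\ lie_group A, simply_connected R G, lie_algebra_chart A mu c,
        connected_lie_subgroup A c (range (@ink R q n)) B iota
      & closed (range iota)].

Definition h3 mu : Prop :=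
  forall (Z : 'cV[R]_q) (X Y : 'cV[R]_n),
    dotv (prp (mu (ink n Z) (inp q X))) Y
    = - dotv X (prp (mu (ink n Z) (inp q Y))).

Definition h4 mu : Prop :=
  forall Z : 'cV[R]_q,
    (forall X : 'cV[R]_n, mu (ink n Z) (inp q X) = 0) -> Z = 0.

Definition Hqn : set (bracket R (q + n)) :=
  [set mu | skew_bilinear mu /\ [/\ h1 mu, h2 mu, h3 mu & h4 mu]].

(* Differentiability of a curve in the finite-dimensional space V_{q+n} is
   evaluated on each pair of vectors. *)
Definition bracket_flow (I : set R) (mu : R -> bracket R (q + n)) : Prop :=
  forall t, I t -> forall X Y,
    is_derive t (1 : R) (fun s => mu s X Y)
      (- piact (ext0 q (Ric (mu t))) (mu t) X Y).

End Hspace.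

Section Meaning.
Variable R : realType.

Lemma dotv_stdb m (X : 'cV[R]_m) i : dotv X (stdb R i) = X i 0.
Proof.
rewrite /dotv (bigD1 i)//= big1 => [|j ji]; rewrite !mxE ?eqxx ?mulr1 ?addr0//.
by rewrite (negbTE ji) mulr0.
Qed.

Lemma col_stdb m (X : 'cV[R]_m) : X = \sum_i X i 0 *: stdb R i.
Proof.
apply/colP => i; rewrite summxE (bigD1 i)//= big1 => [|j ji];
  rewrite !mxE ?eqxx ?mulr1 ?addr0//.
by rewrite eq_sym (negbTE ji) mulr0.
Qed.

Lemma linear_expand (U V : lmodType R) (I : finType) (f : U -> V) (a : I -> R)
    (v : I -> U) :
  linear f -> f (\sum_i a i *: v i) = \sum_i a i *: f (v i).
Proof.
move=> lf; pose g : {linear U -> V} :=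
  HB.pack f (GRing.isLinear.Build R U V *:%R f lf).
rewrite -[f]/(g : U -> V) linear_sum.
by apply: eq_bigr => i _; rewrite linearZ.
Qed.

Lemma dotvDl m (Y : 'cV[R]_m) : linear (fun X => dotv X Y : R^o).
Proof.
move=> a X X'; rewrite /dotv scaler_sumr -big_split; apply: eq_bigr => i _ /=.
by rewrite !mxE mulrDl -mulrA.
Qed.

Lemma dotvC m (X Y : 'cV[R]_m) : dotv X Y = dotv Y X.
Proof. by apply: eq_bigr => i _; rewrite mulrC. Qed.

Lemma dotvDr m (X : 'cV[R]_m) : linear (fun Y => dotv X Y : R^o).
Proof. by move=> a Y Y'; rewrite !(dotvC X) dotvDl. Qed.

Lemma ad_mulmx m (mu : bracket R m) (X Y : 'cV[R]_m) :
  linear (mu X) -> ad mu X *m Y = mu X Y.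
Proof.
move=> lmu; rewrite [in RHS](col_stdb Y) linear_expand//.
apply/colP => i; rewrite summxE mxE; apply: eq_bigr => j _.
by rewrite !mxE mulrC.
Qed.

Lemma ad_linear m (mu : bracket R m) : skew_bilinear mu -> linear (ad mu).
Proof.
by move=> [_ lmu _] a X Y; apply/matrixP => i j; rewrite !mxE lmu !mxE.
Qed.

Lemma HvecP m (la : bracket R m) (X : 'cV[R]_m) :
  skew_bilinear la -> dotv (Hvec la) X = \tr (ad la X).
Proof.
move=> lla; rewrite [in RHS](col_stdb X) (linear_expand _ _ (ad_linear lla)).
rewrite raddf_sum /=; apply: eq_bigr => i _; rewrite mxE mxtraceZ mulrC.
by [].
Qed.

Lemma op_of_formP m (b : 'cV[R]_m -> 'cV[R]_m -> R) (X Y : 'cV[R]_m) :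
  (forall X, linear (b X : _ -> R^o)) ->
  (forall Y, linear (b^~ Y : _ -> R^o)) ->
  dotv ((\matrix_(i, j) b (stdb R j) (stdb R i)) *m X) Y = b X Y.
Proof.
move=> lr ll; rewrite [in RHS](col_stdb Y) (linear_expand _ _ (lr X)).
apply: eq_bigr => i _; rewrite mxE mulrC [in RHS](col_stdb X).
rewrite (linear_expand _ _ (ll (stdb R i))); congr (_ * _).
by apply: eq_bigr => j _; rewrite !mxE mulrC.
Qed.

Lemma MopP m (la : bracket R m) (X Y : 'cV[R]_m) :
  skew_bilinear la -> dotv (Mop la *m X) Y = Mform la X Y.
Proof.
move=> [_ ll _].
have MC (U W : 'cV[R]_m) : Mform la U W = Mform la W U.
  by rewrite /Mform; congr (_ * _ + _ * _);
    apply: eq_bigr => i _; apply: eq_bigr => j _; rewrite mulrC.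
have lM W : linear (Mform la ^~ W : _ -> R^o).
  move=> a U V; rewrite /Mform scalerDr addrACA; congr (_ + _).
    rewrite -[_ *: (_ * _)]/(_ * (_ * _)) mulrCA -mulrDr; congr (_ * _).
    rewrite mulr_sumr -big_split; apply: eq_bigr => i _ /=.
    rewrite mulr_sumr -big_split; apply: eq_bigr => j _ /=.
    by rewrite ll dotvDl mulrDl mulrA.
  rewrite -[_ *: (_ * _)]/(_ * (_ * _)) mulrCA -mulrDr; congr (_ * _).
  rewrite mulr_sumr -big_split; apply: eq_bigr => i _ /=.
  rewrite mulr_sumr -big_split; apply: eq_bigr => j _ /=.
  by rewrite dotvDr mulrDl mulrA.
by apply: op_of_formP => // U a V W; rewrite MC lM !(MC _ U).
Qed.

Lemma BopP q n (mu : bracket R (q + n)) (X Y : 'cV[R]_n) :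
  skew_bilinear mu ->
  dotv (Bop mu *m X) Y = \tr (ad mu (inp q X) *m ad mu (inp q Y)).
Proof.
move=> lmu.
have linp : linear (fun X => ad mu (inp q X)).
  move=> a U V; rewrite -(ad_linear lmu); congr (ad mu _).
  by rewrite /inp scale_col_mx add_col_mx scaler0 addr0.
apply: (op_of_formP
  (b := fun X Y => \tr (ad mu (inp q X) *m ad mu (inp q Y)))) => Z a U V.
  by rewrite linp mulmxDr mxtraceD -scalemxAr mxtraceZ.
by rewrite linp mulmxDl mxtraceD -scalemxAl mxtraceZ.
Qed.

Lemma delta_linear m (la : bracket R m) (X Y : 'cV[R]_m) :
  skew_bilinear la -> linear (fun E => delta la E X Y).
Proof.
move=> [lr ll _] a E F; rewrite /delta /piact !mulmxDl -!scalemxAl.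
rewrite lr ll scalerN -opprD; congr (- _).
move: (E *m la X Y) (F *m la X Y) (la (E *m X) Y) (la (F *m X) Y)
  (la X (E *m Y)) (la X (F *m Y)).
by move=> p p' r r' s s'; apply/colP => k; rewrite !mxE; ring.
Qed.

Lemma dotM_deltaT m (la nu : bracket R m) (E : 'M[R]_m) :
  skew_bilinear la -> dotM (deltaT la nu) E = dotV nu (delta la E).
Proof.
move=> lla; pose f F : R^o := dotV nu (delta la F).
have lf : linear f.
  move=> a F G; rewrite /f /dotV scaler_sumr -big_split; apply: eq_bigr => i _.
  rewrite scaler_sumr -big_split; apply: eq_bigr => j _ /=.
  by rewrite (delta_linear _ _ lla) dotvDr.
rewrite -[RHS]/(f E) [in RHS](matrix_sum_delta E) pair_big/=.
rewrite (linear_expand _ _ lf) -(pair_big xpredT xpredT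
  (fun i j => E i j *: f (delta_mx i j)))/=.
apply: eq_bigr => i _; rewrite mxE; apply: eq_bigr => j _.
by rewrite !mxE mulrC.
Qed.

End Meaning.

(* Main.v *)
Require Import Defs.
From mathcomp Require Import all_boot all_order all_algebra.
From mathcomp Require Import ring.
From mathcomp Require Import all_classical all_reals all_analysis.
Set Implicit Arguments.
Unset Strict Implicit.
Unset Printing Implicit Defensive.
Import Order.TTheory GRing.Theory Num.Theory.
Import numFieldNormedType.Exports.
Local Open Scope classical_set_scope.
Local Open Scope ring_scope.

(* Idea.  With la = mu_p and E = Ric, the flow gives la' = delta la E, because
   ext0 E acts on p only.  All derivatives then follow from bilinearity and two
   facts: M_la = - 1/4 deltaT la la (moment map), and the transpose of pi(E) is
   pi(E^T).  Only (vi) and (ix) use that mu is a homogeneous space; they amount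
   to <Ric H, H> = tr (Ric ad_la H) = - tr (S(ad_la H)^2).  For these, k acts on
   itself by operators skew for the inner product - tr (ad Z|p ad W|p),
   definite by (h4), so that tr ad_mu W = <H, W_p> for all W.  Hence
   <H, [g, g]_p> = 0, and [k, H] = 0 by (h3).  The k-component b of
   ad_mu H : p -> g prevents ad_la H from being a derivation of la, so neither
   tr (M ad_la H) nor tr (B ad_la H) need vanish, but by Jacobi the defects
   cancel in tr (M ad_la H) - 1/2 tr (B ad_la H). *)

(** * Derivatives of matrix-valued curves *)

Section MatrixDerivatives.
Variables (R : realType) (t : R).

Lemma is_derive_mxP (m n : nat) (M : R -> 'M[R]_(m, n)) (dM : 'M[R]_(m, n)) :
  is_derive t (1 : R) M dM <->
  forall i j, is_derive t (1 : R) (fun s => M s i j) (dM i j).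
Proof.
split=> [[Md MdE] i j|Md].
  apply: DeriveDef; first exact: (derivable_mxP _ _ _).1.
  by rewrite -MdE derive_mx// mxE.
have Mdv : derivable M t (1 : R).
  by apply/derivable_mxP => i j; case: (Md i j).
apply: DeriveDef => //; rewrite derive_mx//.
by apply/matrixP => i j; rewrite mxE; case: (Md i j).
Qed.

Lemma is_derive_fsum (V : normedModType R) (J : finType) (f : J -> R -> V)
    (df : J -> V) :
  (forall j, is_derive t (1 : R) (f j) (df j)) ->
  is_derive t (1 : R) (fun s => \sum_j f j s) (\sum_j df j).
Proof.
move=> fd; elim: (index_enum J) => [|j r IH].
  rewrite big_nil (_ : (fun _ => _) = cst 0); first exact: is_derive_cst.
  by apply/funext => s; rewrite big_nil.
rewrite big_cons.
rewrite (_ : (fun _ => _) = f j + (fun s => \sum_(i <- r) f i s)).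
  exact: is_deriveD.
by apply/funext => s; rewrite big_cons.
Qed.

Lemma is_derive_mulr (f g : R -> R) (df dg : R) :
  is_derive t (1 : R) f df -> is_derive t (1 : R) g dg ->
  is_derive t (1 : R) (fun s => f s * g s) (df * g t + f t * dg).
Proof.
move=> fd gd; apply: (is_derive_eq (is_deriveM fd gd)).
by rewrite addrC /GRing.scale/= [g t * _]mulrC.
Qed.

Lemma is_derive_mulmx (m n p : nat) (f : R -> 'M[R]_(m, n))
    (g : R -> 'M[R]_(n, p)) (df : 'M[R]_(m, n)) (dg : 'M[R]_(n, p)) :
  is_derive t (1 : R) f df -> is_derive t (1 : R) g dg ->
  is_derive t (1 : R) (fun s => f s *m g s) (df *m g t + f t *m dg).
Proof.
move=> /is_derive_mxP fd /is_derive_mxP gd; apply/is_derive_mxP => i j.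
rewrite (_ : (fun _ => _) = (fun s => \sum_k f s i k * g s k j)); last first.
  by apply/funext => s; rewrite mxE.
apply: is_derive_eq
  (is_derive_fsum (fun k => is_derive_mulr (fd i k) (gd k j))) _.
by rewrite !mxE -big_split.
Qed.

Lemma is_derive_mxtrace (m : nat) (f : R -> 'M[R]_m) (df : 'M[R]_m) :
  is_derive t (1 : R) f df -> is_derive t (1 : R) (fun s => \tr (f s)) (\tr df).
Proof. by move=> /is_derive_mxP fd; exact: is_derive_fsum. Qed.

Lemma is_derive_symp (m : nat) (f : R -> 'M[R]_m) (df : 'M[R]_m) :
  is_derive t (1 : R) f df ->
  is_derive t (1 : R) (fun s => symp (f s)) (symp df).
Proof.
move=> /is_derive_mxP fd; apply/is_derive_mxP => i j.
rewrite (_ : (fun _ => _) = 2^-1 \*: ((fun s => f s i j) + (fun s => f s j i))).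
  by rewrite !mxE; apply: is_deriveZ; exact: is_deriveD.
by apply/funext => s; rewrite !mxE.
Qed.

Lemma is_derive_dotv (m : nat) (f g : R -> 'cV[R]_m) (df dg : 'cV[R]_m) :
  is_derive t (1 : R) f df -> is_derive t (1 : R) g dg ->
  is_derive t (1 : R) (fun s => dotv (f s) (g s))
    (dotv df (g t) + dotv (f t) dg).
Proof.
move=> /is_derive_mxP fd /is_derive_mxP gd.
apply: is_derive_eq
  (is_derive_fsum (fun i => is_derive_mulr (fd i 0) (gd i 0))) _.
by rewrite big_split.
Qed.

End MatrixDerivatives.

(** * Derivatives of the constructions attached to a curve of brackets *)

Section BracketDerivatives.
Variables (R : realType) (t : R) (m : nat).
Implicit Types (la : R -> bracket R m) (dla : bracket R m).

Definition is_derive_bracket la dla : Prop :=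
  forall X Y, is_derive t (1 : R) (fun s => la s X Y) (dla X Y).

Lemma is_derive_ad la dla X :
  is_derive_bracket la dla ->
  is_derive t (1 : R) (fun s => ad (la s) X) (ad dla X).
Proof.
move=> lad; apply/is_derive_mxP => i j; rewrite mxE.
rewrite (_ : (fun _ => _) = (fun s => la s X (stdb R j) i 0)).
  exact: (is_derive_mxP _ _ _).1.
by apply/funext => s; rewrite mxE.
Qed.

Lemma is_derive_dotV la nu dla dnu :
  is_derive_bracket la dla -> is_derive_bracket nu dnu ->
  is_derive t (1 : R) (fun s => dotV (la s) (nu s))
    (dotV dla (nu t) + dotV (la t) dnu).
Proof.
move=> lad nud.
apply: is_derive_eq (is_derive_fsum (fun i => is_derive_fsum (fun j =>
  is_derive_dotv (lad _ (stdb R j)) (nud (stdb R i) _)))) _.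
by rewrite -big_split; apply: eq_bigr => i _; rewrite -big_split.
Qed.

Lemma is_derive_delta la dla E :
  is_derive_bracket la dla ->
  is_derive_bracket (fun s => delta (la s) E) (delta dla E).
Proof.
move=> lad X Y; apply: is_deriveN; apply: is_deriveB; last exact: lad.
apply: is_deriveB; last exact: lad.
have dE : is_derive t (1 : R) (fun=> E) 0 by exact: is_derive_cst.
by apply: is_derive_eq (is_derive_mulmx dE (lad X Y)) _; rewrite mul0mx add0r.
Qed.

Lemma is_derive_deltaT la nu dla dnu :
  is_derive_bracket la dla -> is_derive_bracket nu dnu ->
  is_derive t (1 : R) (fun s => deltaT (la s) (nu s))
    (deltaT (la t) dnu + deltaT dla (nu t)).
Proof.
move=> lad nud; apply/is_derive_mxP => i j.
rewrite (_ : (fun _ => _) =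
    (fun s => dotV (nu s) (delta (la s) (delta_mx i j)))).
  by rewrite !mxE; apply: is_derive_dotV => //; exact: is_derive_delta.
by apply/funext => s; rewrite mxE.
Qed.

Lemma is_derive_Hvec la dla :
  is_derive_bracket la dla ->
  is_derive t (1 : R) (fun s => Hvec (la s)) (Hvec dla).
Proof.
move=> lad; apply/is_derive_mxP => i j; rewrite mxE.
rewrite (_ : (fun _ => _) = (fun s => \tr (ad (la s) (stdb R i)))).
  by apply: is_derive_mxtrace; exact: is_derive_ad.
by apply/funext => s; rewrite mxE.
Qed.

(** Expanding the moving vector in the standard basis reduces the claim to the product rule with
    fixed basis vectors. The expansion uses the linearity of [ad (la s)], hence the hypothesis on a
    neighbourhood of [t]. *)
Lemma is_derive_ad_curve la dla (X : R -> 'cV[R]_m) dX :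
  (\near t, skew_bilinear (la t)) -> skew_bilinear dla ->
  is_derive_bracket la dla -> is_derive t (1 : R) X dX ->
  is_derive t (1 : R) (fun s => ad (la s) (X s)) (ad dla (X t) + ad (la t) dX).
Proof.
move=> lask dlask lad /is_derive_mxP Xd; have latsk := nbhs_singleton lask.
have adE (mu : bracket R m) Y : skew_bilinear mu ->
    ad mu Y = \sum_k Y k 0 *: ad mu (stdb R k).
  by move=> musk; rewrite {1}(col_stdb Y) (linear_expand _ _ (ad_linear musk)).
apply: (@near_eq_is_derive _ _ _
    (fun s => \sum_k X s k 0 *: ad (la s) (stdb R k))).
  by apply: filterS lask => s lask; rewrite -adE.
rewrite addrC adE// [ad dla _]adE//.
rewrite -big_split; apply: is_derive_fsum => k /=.
apply/is_derive_mxP => i j.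
have /is_derive_mxP/(_ i j) adk := is_derive_ad (stdb R k) lad.
rewrite (_ : (fun _ => _) = (fun s => X s k 0 * ad (la s) (stdb R k) i j)).
  by apply: is_derive_eq (is_derive_mulr (Xd k 0) adk) _; rewrite !mxE.
by apply/funext => s; rewrite mxE.
Qed.

End BracketDerivatives.

(** * Euclidean inner products, traces and symmetric parts of matrices *)

Section EuclideanOperators.
Variables (R : realType) (m : nat).
Implicit Types (X Y : 'cV[R]_m) (A C E : 'M[R]_m).

Lemma dotvE X Y : dotv X Y = \tr (X *m Y^T).
Proof. by apply: eq_bigr => i _; rewrite !mxE big_ord1 !mxE. Qed.

Lemma dotv0r X : dotv X 0 = 0.
Proof. by rewrite dotvE trmx0 mulmx0 mxtrace0. Qed.

Lemma dotvDRr X Y Y' : dotv X (Y + Y') = dotv X Y + dotv X Y'.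
Proof. by have := dotvDr X 1 Y Y'; rewrite !scale1r. Qed.

Lemma dotvNr X Y : dotv X (- Y) = - dotv X Y.
Proof. by rewrite !dotvE linearN mulmxN linearN. Qed.

Lemma dotv_mulmxl E X Y : dotv (E *m X) Y = dotv X (E^T *m Y).
Proof. by rewrite !dotvE trmx_mul trmxK mulmxA [RHS]mxtrace_mulC !mulmxA. Qed.

Lemma dotv_inj X : (forall Y, dotv X Y = 0) -> X = 0.
Proof. by move=> X0; apply/colP => i; rewrite mxE -dotv_stdb. Qed.

Lemma mulmx_stdb p (A : 'M[R]_(p, m)) j i : (A *m stdb R j) i 0 = A i j.
Proof. by rewrite -colE mxE. Qed.

Lemma mulmx_injr p (A C : 'M[R]_(p, m)) :
  (forall X : 'cV[R]_m, A *m X = C *m X) -> A = C.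
Proof.
by move=> eqAC; apply/matrixP => i j; rewrite -[LHS]mulmx_stdb eqAC mulmx_stdb.
Qed.

Lemma mxtrace_dotv A : \tr A = \sum_i dotv (A *m stdb R i) (stdb R i).
Proof. by apply: eq_bigr => i _; rewrite dotv_stdb mulmx_stdb. Qed.

Lemma dotM_dotv A C :
  dotM A C = \sum_i dotv (A *m stdb R i) (C *m stdb R i).
Proof.
rewrite /dotM mxtrace_mulC mxtrace_dotv; apply: eq_bigr => i _.
by rewrite -mulmxA dotv_mulmxl trmxK.
Qed.

Lemma dotM_eq0 A : dotM A A = 0 -> A = 0.
Proof.
move=> AA0; apply/matrixP => i j; rewrite mxE; move/eqP: AA0.
have sq k : (A *m A^T) k k = \sum_l A k l ^+ 2.
  by rewrite mxE; apply: eq_bigr => l _; rewrite mxE expr2.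
rewrite /dotM /mxtrace (eq_bigr _ (fun k _ => sq k)).
rewrite psumr_eq0 => [/allP/(_ i)|k _]; last first.
  by apply: sumr_ge0 => l _; exact: sqr_ge0.
rewrite mem_index_enum psumr_eq0 => [/(_ isT)/allP/(_ j)|l _].
  by rewrite mem_index_enum sqrf_eq0 => /(_ isT)/eqP.
exact: sqr_ge0.
Qed.

Lemma mxtraceB A C : \tr (A - C) = \tr A - \tr C.
Proof. exact: linearB. Qed.

Lemma mxtrace_lie A C : \tr ((A *m C - C *m A) *m C) = 0.
Proof.
by rewrite mulmxBl mxtraceB [\tr (A *m C *m C)]mxtrace_mulC mulmxA subrr.
Qed.

(** The commutator with a skew matrix is infinitesimal conjugation by orthogonal matrices, which
    preserves [dotM]. *)
Lemma dotM_lie E A C : E^T = - E ->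
  dotM (E *m A - A *m E) C + dotM A (E *m C - C *m E) = 0.
Proof.
move=> Ek; rewrite /dotM; have -> : (E *m C - C *m E)^T = E *m C^T - C^T *m E.
  by rewrite linearB /= !trmx_mul Ek mulmxN mulNmx opprK addrC.
rewrite mulmxBl mulmxBr !mxtraceB !mulmxA.
by rewrite [\tr (A *m C^T *m E)]mxtrace_mulC !mulmxA; ring.
Qed.

Lemma tr_symp A : (symp A)^T = symp A.
Proof. by rewrite /symp linearZ linearD /= trmxK addrC. Qed.

Lemma mxtrace_symp A : \tr (symp A) = \tr A.
Proof. by rewrite linearZ linearD /= mxtrace_tr; field. Qed.

Lemma mxtrace_mul_symp A C : A^T = A -> \tr (A *m symp C) = \tr (A *m C).
Proof.
move=> As; rewrite /symp -scalemxAr mulmxDr linearZ linearD /=.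
by rewrite -[\tr (A *m C^T)]mxtrace_tr trmx_mul trmxK As mxtrace_mulC; field.
Qed.

Lemma mxtrace_symp_sqr A :
  \tr (symp A *m symp A) = 2^-1 * (dotM A A + \tr (A *m A)).
Proof.
rewrite mxtrace_mul_symp ?tr_symp// /symp -scalemxAl mulmxDl linearZ linearD /=.
by rewrite [\tr (A^T *m _)]mxtrace_mulC addrC.
Qed.

End EuclideanOperators.

(** * The action of gl_m on skew brackets and its moment map *)

Section SkewBrackets.
Variables (R : realType) (m : nat).
Implicit Types (la nu : bracket R m) (X Y Z : 'cV[R]_m) (E F : 'M[R]_m).

Lemma skew_bilinear_adE la X Y : skew_bilinear la -> la X Y = ad la X *m Y.
Proof. by case=> l _ _; rewrite ad_mulmx. Qed.

Lemma bracketC la X Y : skew_bilinear la -> la X Y = - la Y X.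
Proof. by case=> _ _; apply. Qed.

Lemma bracketDr la X Y Z : skew_bilinear la -> la X (Y + Z) = la X Y + la X Z.
Proof. by move=> las; rewrite !(skew_bilinear_adE X)// mulmxDr. Qed.

Lemma bracketNr la X Y : skew_bilinear la -> la X (- Y) = - la X Y.
Proof. by move=> las; rewrite !(skew_bilinear_adE X)// mulmxN. Qed.

Lemma bracket_diag la X : skew_bilinear la -> la X X = 0.
Proof.
move=> las; apply/colP => i; have /colP/(_ i) := bracketC X X las.
by rewrite !mxE => /eqP; rewrite -addr_eq0 -mulr2n mulrn_eq0/= => /eqP.
Qed.

Lemma deltaE la E X Y :
  delta la E X Y = la (E *m X) Y + la X (E *m Y) - E *m la X Y.
Proof. by rewrite /delta /piact !opprB addrCA addrA. Qed.

Lemma skew_delta la E : skew_bilinear la -> skew_bilinear (delta la E).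
Proof.
move=> las; have [lr ll ls] := las; split.
- move=> X a Y Z; rewrite !deltaE mulmxDr -scalemxAr !lr mulmxDr -scalemxAr.
  by apply/colP => i; rewrite !mxE; ring.
- move=> X a Y Z; rewrite !deltaE mulmxDr -scalemxAr !ll mulmxDr -scalemxAr.
  by apply/colP => i; rewrite !mxE; ring.
- move=> X Y; rewrite !deltaE (ls (E *m X)) (ls X (E *m Y)) (ls X Y) mulmxN.
  by rewrite !opprD [- la Y _ + _]addrC.
Qed.

Lemma ad_delta la E X : skew_bilinear la ->
  ad (delta la E) X = ad la (E *m X) + ad la X *m E - E *m ad la X.
Proof.
move=> las; apply: mulmx_injr => Y; rewrite mulmxBl mulmxDl -!mulmxA.
by rewrite -!skew_bilinear_adE ?deltaE//; exact: skew_delta.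
Qed.

(** The two other terms of [ad_delta] form a commutator, which is traceless. This makes [Hvec]
    evolve linearly under the flow. *)
Lemma mxtrace_ad_delta la E X : skew_bilinear la ->
  \tr (ad (delta la E) X) = \tr (ad la (E *m X)).
Proof.
by move=> las; rewrite ad_delta// linearB linearD/= mxtrace_mulC addrK.
Qed.

Lemma dotVC la nu : dotV la nu = dotV nu la.
Proof. by do 2 (apply: eq_bigr => ? _); rewrite dotvC. Qed.

(* The factor 2 merges the slots [la (E X) Y] and [la X (E Y)], equal by
   skew-symmetry. *)
Lemma dotV_delta la nu E : skew_bilinear la -> skew_bilinear nu ->
  dotV nu (delta la E)
  = 2 * \sum_i dotM (ad nu (stdb R i)) (ad la (E *m stdb R i))
    - \sum_i dotM (ad nu (stdb R i)) (E *m ad la (stdb R i)).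
Proof.
move=> las nus; rewrite /dotV.
under eq_bigr => i _ do
  under eq_bigr => j _ do rewrite deltaE !dotvDRr dotvNr.
under eq_bigr => i _ do rewrite big_split/= big_split/= sumrN.
rewrite big_split/= big_split/= sumrN; congr (_ - _); last first.
  apply: eq_bigr => i _; rewrite dotM_dotv; apply: eq_bigr => j _.
  by rewrite -mulmxA -!skew_bilinear_adE.
rewrite [X in _ + X]exchange_big/= mulr2n mulrDl !mul1r.
congr (_ + _); apply: eq_bigr => i _; rewrite dotM_dotv; apply: eq_bigr => j _;
  rewrite -!skew_bilinear_adE//.
by rewrite (bracketC (stdb R j) (stdb R i) nus) (bracketC _ (E *m _) las)
  dotvNr dotvC dotvNr dotvC opprK.
Qed.

(** Exposes the entries of [E], so that transposing [E] becomes an exchange of the two summation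
    indices. *)
Lemma sum_dotM_ad_mulmx la nu E : skew_bilinear la ->
  \sum_i dotM (ad nu (stdb R i)) (ad la (E *m stdb R i))
  = \sum_i \sum_k E k i * dotM (ad nu (stdb R i)) (ad la (stdb R k)).
Proof.
move=> las; apply: eq_bigr => i _.
rewrite [E *m _]col_stdb (linear_expand _ _ (ad_linear las)) /dotM.
rewrite linear_sum mulmx_sumr linear_sum /=; apply: eq_bigr => k _.
by rewrite linearZ -scalemxAr linearZ /= mulmx_stdb.
Qed.

(** The two sums of [dotV_delta] match separately: the first by exchanging indices, the second by
    moving [E] across the inner product. *)
Lemma dotV_delta_tr la nu E : skew_bilinear la -> skew_bilinear nu ->
  dotV nu (delta la E) = dotV (delta nu E^T) la.
Proof.
move=> las nus; rewrite [RHS]dotVC !dotV_delta//; congr (2 * _ - _).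
  rewrite !sum_dotM_ad_mulmx// exchange_big; apply: eq_bigr => i _.
  apply: eq_bigr => k _; rewrite mxE; congr (_ * _).
  by rewrite /dotM -mxtrace_tr trmx_mul trmxK.
apply: eq_bigr => i _; rewrite !dotM_dotv; apply: eq_bigr => k _.
by rewrite -!mulmxA dotvC dotv_mulmxl.
Qed.

(** At [nu = la] this makes [deltaT la la] symmetric; in its derivative it makes the two
    product-rule terms transposes of each other, which is where the symmetrization in [Delta] comes
    from. *)
Lemma deltaT_tr la nu : skew_bilinear la -> skew_bilinear nu ->
  deltaT nu la = (deltaT la nu)^T.
Proof.
move=> las nus; apply/matrixP => i j; rewrite !mxE dotV_delta_tr//.
by rewrite trmx_delta dotVC.
Qed.

Lemma Mform_stdb la i j : skew_bilinear la ->
  Mform la (stdb R j) (stdb R i) =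
  - 2^-1 * dotM (ad la (stdb R j)) (ad la (stdb R i))
  + 4^-1 * \sum_k (ad la (stdb R k) *m (ad la (stdb R k))^T) j i.
Proof.
move=> las; rewrite /Mform dotM_dotv; congr (_ * _ + _ * _).
  apply: eq_bigr => k _; rewrite -!skew_bilinear_adE//; apply: eq_bigr => l _.
  by rewrite !dotv_stdb.
apply: eq_bigr => k _; rewrite mxE; apply: eq_bigr => l _.
by rewrite !dotv_stdb !mxE.
Qed.

(** At a matrix unit, [dotV_delta] gives 2 times the first sum of [Mform] minus the second, and the
    factor -1/4 turns these into the coefficients -1/2 and 1/4. *)
Lemma Mop_deltaT la : skew_bilinear la -> Mop la = - 4^-1 *: deltaT la la.
Proof.
move=> las; apply/matrixP => a b; rewrite !mxE Mform_stdb// dotV_delta//.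
have -> : \sum_i dotM (ad la (stdb R i)) (delta_mx a b *m ad la (stdb R i)) =
    \sum_k (ad la (stdb R k) *m (ad la (stdb R k))^T) b a.
  apply: eq_bigr => i _; rewrite /dotM trmx_mul trmx_delta mulmxA.
  have /matrixP/(_ a b) : (ad la (stdb R i) *m (ad la (stdb R i))^T)^T =
    ad la (stdb R i) *m (ad la (stdb R i))^T by rewrite trmx_mul trmxK.
  rewrite mxE => ->; move: (_ *m _^T) => C.
  rewrite /mxtrace (bigD1 a)//= big1 => [|k ka].
    rewrite addr0 mxE (bigD1 b)//= big1 => [|l lb].
      by rewrite mxE !eqxx mulr1 addr0.
    by rewrite mxE (negbTE lb) mulr0.
  by rewrite mxE big1// => l _; rewrite mxE (negbTE ka) andbF mulr0.
(* In the remaining double sum the matrix unit keeps only the term [i = b], [k = a]. *)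
move: (\sum_k _) => T; rewrite sum_dotM_ad_mulmx// (bigD1 b)//=.
rewrite [X in 2 * (_ + X)]big1 => [|i ib]; last first.
  by rewrite big1// => k _; rewrite mxE (negbTE ib) andbF mul0r.
rewrite (bigD1 a)//= [X in 2 * (_ + X + _)]big1 => [|k ka]; last first.
  by rewrite mxE (negbTE ka) mul0r.
by rewrite mxE !eqxx mul1r !addr0; field.
Qed.

Lemma tr_Mop la : skew_bilinear la -> (Mop la)^T = Mop la.
Proof. by move=> las; rewrite Mop_deltaT// linearZ/= -deltaT_tr. Qed.

(* [Mop] is the moment map of the action of gl_n on brackets. *)
Lemma mxtrace_Mop_mul la E : skew_bilinear la ->
  \tr (Mop la *m E) = - 4^-1 * dotV la (delta la E).
Proof.
move=> las; rewrite -dotM_deltaT// Mop_deltaT// /dotM -scalemxAl linearZ /=.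
congr (_ * _).
by rewrite -[LHS]mxtrace_tr trmx_mul -deltaT_tr// mxtrace_mulC.
Qed.

Lemma delta1 la X Y : skew_bilinear la -> delta la 1%:M X Y = la X Y.
Proof. by move=> las; rewrite deltaE !mul1mx addrK. Qed.

(** The trace is the pairing with the identity, and [delta la 1%:M] is [la] itself, so the moment
    map identity applies. *)
Lemma mxtrace_Delta la E : skew_bilinear la ->
  \tr (Delta la E) = - 4 * \tr (Mop la *m E).
Proof.
move=> las; rewrite /Delta mxtrace_symp mxtrace_Mop_mul// mulrA mulrNN.
rewrite mulfV// mul1r -[deltaT _ _]mulmx1 -[1%:M]trmx1 -/(dotM _ _).
rewrite dotM_deltaT// dotVC.
by do 2 (apply: eq_bigr => ? _); rewrite delta1.
Qed.

Lemma ad_jacobi la X Y : skew_bilinear la -> jacobi la ->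
  ad la (la X Y) = ad la X *m ad la Y - ad la Y *m ad la X.
Proof.
move=> las laj; apply: mulmx_injr => Z; rewrite mulmxBl -!mulmxA.
rewrite -!skew_bilinear_adE// (bracketC (la X Y))//.
have /eqP := laj X Y Z; rewrite addr_eq0 => /eqP <-.
by rewrite (bracketC _ X las) bracketNr.
Qed.

Lemma Mform_diag la X : skew_bilinear la ->
  Mform la X X = - 2^-1 * dotM (ad la X) (ad la X)
    + 4^-1 * \sum_i \sum_j dotv (la (stdb R i) (stdb R j)) X ^+ 2.
Proof.
move=> las; rewrite /Mform dotM_dotv; congr (_ * _ + _).
apply: eq_bigr => i _; rewrite -!skew_bilinear_adE//; apply: eq_bigr => j _.
by rewrite dotv_stdb.
Qed.

End SkewBrackets.

(** * The splitting g = k + p and block matrices *)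

Section Blocks.
Variables (R : realType) (q n : nat).
Implicit Types (mu : bracket R (q + n)) (E : 'M[R]_n) (W : 'cV[R]_(q + n)).

Lemma col_ink_inp W : W = ink n (prk W) + inp q (prp W).
Proof. by rewrite /ink /inp add_col_mx addr0 add0r vsubmxK. Qed.

Lemma prpD W W' : prp (W + W') = prp W + prp W'.
Proof. exact: linearD. Qed.

Lemma prpN W : prp (- W) = - prp W.
Proof. exact: linearN. Qed.

Lemma prp_ink (Z : 'cV[R]_q) : prp (ink n Z) = 0.
Proof. exact: col_mxKd. Qed.

Lemma prp_inp (X : 'cV[R]_n) : prp (inp q X) = X.
Proof. exact: col_mxKd. Qed.

Lemma ext0_inp E X : ext0 q E *m inp q X = inp q (E *m X).
Proof.
by rewrite /ext0 /inp mul_block_col !(mul0mx, mulmx0) addr0 add0r.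
Qed.

Lemma prp_ext0 E W : prp (ext0 q E *m W) = E *m prp W.
Proof.
rewrite {1}(col_ink_inp W) mulmxDr ext0_inp /ext0 /ink mul_block_col.
by rewrite !(mul0mx, mulmx0, addr0) prpD prp_inp /prp col_mxKd add0r.
Qed.

Lemma skew_mu_p mu : skew_bilinear mu -> skew_bilinear (mu_p mu).
Proof.
have inpl a X Y : inp q (a *: X + Y) = a *: inp q X + inp q Y :> 'cV[R]__.
  by rewrite /inp scale_col_mx add_col_mx scaler0 addr0.
case=> lr ll ls; split=> X; rewrite /mu_p.
- by move=> a Y Z; rewrite inpl lr /prp linearP.
- by move=> a Y Z; rewrite inpl ll /prp linearP.
- by move=> Y; rewrite ls prpN.
Qed.

(** Both [inp] and [prp] intertwine [ext0 q E] with [E]; this carries the flow of [mu] over to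
    [mu_p]. *)
Lemma mu_p_delta mu E X Y :
  mu_p (delta mu (ext0 q E)) X Y = delta (mu_p mu) E X Y.
Proof. by rewrite /mu_p !deltaE !prpD prpN prp_ext0 !ext0_inp. Qed.

Lemma ad_block_ink mu W Z : skew_bilinear mu ->
  mu W (ink n Z) = col_mx (ulsubmx (ad mu W) *m Z) (dlsubmx (ad mu W) *m Z).
Proof.
move=> mus; rewrite skew_bilinear_adE// -{1}[ad mu W]submxK mul_block_col.
by rewrite !mulmx0 !addr0.
Qed.

Lemma ad_block_inp mu W X : skew_bilinear mu ->
  mu W (inp q X) = col_mx (ursubmx (ad mu W) *m X) (drsubmx (ad mu W) *m X).
Proof.
move=> mus; rewrite skew_bilinear_adE// -{1}[ad mu W]submxK mul_block_col.
by rewrite !mulmx0 !add0r.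
Qed.

Lemma drsubmx_ad_inp mu X : skew_bilinear mu ->
  drsubmx (ad mu (inp q X)) = ad (mu_p mu) X.
Proof.
move=> mus; apply: mulmx_injr => Y.
rewrite -[RHS]skew_bilinear_adE; last exact: skew_mu_p.
rewrite -[RHS]/(prp _) ad_block_inp//.
by rewrite /prp col_mxKd.
Qed.

Lemma tr_Bop mu : (Bop mu)^T = Bop mu.
Proof. by apply/matrixP => i j; rewrite !mxE mxtrace_mulC. Qed.

Lemma tr_Ric mu : skew_bilinear mu -> (Ric mu)^T = Ric mu.
Proof.
move=> mus; rewrite /Ric !linearB linearZ /= tr_Bop tr_symp tr_Mop//.
exact: skew_mu_p.
Qed.

End Blocks.

(** * Trace identities for the mean curvature vector H of a homogeneous space *)

Section HomogeneousSpace.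
Variables (R : realType) (q n : nat) (mu : bracket R (q + n)).
Hypotheses (mus : skew_bilinear mu) (mu1 : h1 mu) (mu3 : h3 mu) (mu4 : h4 mu).

Let la : bracket R n := mu_p mu.
Let las : skew_bilinear la := skew_mu_p mus.
Let muj : jacobi mu. Proof. by case: mu1. Qed.

(** [theta] is the isotropy representation of k on p, [kappa] the adjoint representation of k. *)
Let theta (Z : 'cV[R]_q) : 'M[R]_n := drsubmx (ad mu (ink n Z)).
Let kappa (Z : 'cV[R]_q) : 'M[R]_q := ulsubmx (ad mu (ink n Z)).

Lemma ad_ink Z : ad mu (ink n Z) = block_mx (kappa Z) 0 0 (theta Z).
Proof.
rewrite -[LHS]submxK; congr block_mx; apply: mulmx_injr => X; rewrite mul0mx.
  have [_ _ /(_ Z X)] := mu1.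
  by rewrite ad_block_inp// /prk col_mxKu.
have [_ /(_ Z X) + _] := mu1.
by rewrite ad_block_ink// /prp col_mxKd.
Qed.

Lemma theta_mul Z X : theta Z *m X = prp (mu (ink n Z) (inp q X)).
Proof. by rewrite ad_block_inp// /prp col_mxKd. Qed.

Lemma kappa_mul Z Y : mu (ink n Z) (ink n Y) = ink n (kappa Z *m Y).
Proof.
rewrite ad_block_ink// /ink; congr col_mx.
by rewrite ad_ink block_mxKdl mul0mx.
Qed.

Lemma ulsubmx_ad_inp X : ulsubmx (ad mu (inp q X)) = 0.
Proof.
apply: mulmx_injr => Z; rewrite mul0mx.
have [_ _ /(_ Z X)] := mu1.
rewrite bracketC// /prk linearN/= => /eqP; rewrite oppr_eq0 => /eqP.
by rewrite ad_block_ink// col_mxKu.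
Qed.

Lemma tr_theta Z : (theta Z)^T = - theta Z.
Proof.
apply: mulmx_injr => X; apply/eqP; rewrite -subr_eq0; apply/eqP/dotv_inj => Y.
rewrite mulNmx opprK dotvC dotvDRr -dotv_mulmxl.
by rewrite !theta_mul mu3 addNr.
Qed.

Lemma theta_linear : linear theta.
Proof.
move=> a Y Z; apply: mulmx_injr => X; rewrite mulmxDl -scalemxAl !theta_mul.
rewrite /prp -linearP; have [_ ll _] := mus; rewrite -ll.
congr (dsubmx (mu _ _)).
by rewrite /ink scale_col_mx add_col_mx scaler0 addr0.
Qed.

Lemma theta_kappa Z Y :
  theta (kappa Z *m Y) = theta Z *m theta Y - theta Y *m theta Z.
Proof.
rewrite {1}/theta -kappa_mul ad_jacobi// !ad_ink !mulmx_block.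
rewrite !(mul0mx, mulmx0, addr0, add0r) opp_block_mx add_block_mx.
by rewrite block_mxKdr.
Qed.

Let gram : 'M[R]_q :=
  \matrix_(i, j) dotM (theta (stdb R j)) (theta (stdb R i)).

Lemma gramP Y Z : dotv (gram *m Y) Z = dotM (theta Y) (theta Z).
Proof.
apply: (op_of_formP (b := fun Y Z => dotM (theta Y) (theta Z))).
  move=> X a U V; rewrite /dotM theta_linear linearP mulmxDr -scalemxAr.
  exact: linearP.
by move=> X a U V; rewrite /dotM theta_linear mulmxDl -scalemxAl linearP.
Qed.

(** For a vector in the kernel of [gram], its image under [theta] has norm zero; the vector then
    acts trivially on p and vanishes by (h4). *)
Lemma gram_unit : gram \in unitmx.
Proof.
rewrite unitmxE unitfE; apply/negP => /det0P[v v0 vG].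
(* [det0P] yields a row vector; symmetry turns it into a column killed by [gram]. *)
have gramT : gram^T = gram.
  by apply/matrixP => i j; rewrite !mxE /dotM -mxtrace_tr trmx_mul trmxK.
have Gv : gram *m v^T = 0 by rewrite -gramT -trmx_mul vG trmx0.
have := gramP v^T v^T; rewrite Gv dotvC dotv0r => /esym Tv0.
suff : v^T = 0 by move/eqP; rewrite trmx_eq0 (negbTE v0).
suff Tv : theta v^T = 0.
  apply: mu4 => X; rewrite ad_block_inp// -/(theta _) Tv mul0mx.
  by rewrite ad_ink block_mxKur mul0mx col_mx0.
exact: dotM_eq0.
Qed.

(* [kappa Z] is skew for the inner product [gram] on k. *)
Lemma mxtrace_kappa Z : \tr (kappa Z) = 0.
Proof.
have gk : gram *m kappa Z = - ((kappa Z)^T *m gram).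
  apply: mulmx_injr => X; apply/eqP; rewrite -subr_eq0; apply/eqP/dotv_inj => Y.
  rewrite mulNmx opprK dotvC dotvDRr -!mulmxA dotvC gramP.
  rewrite [dotv Y _]dotvC dotv_mulmxl trmxK gramP !theta_kappa.
  exact/dotM_lie/tr_theta.
(* Conjugation by the invertible [gram] takes [kappa Z] to minus its transpose. *)
have : \tr (kappa Z) = - \tr (kappa Z).
  rewrite -{1}[kappa Z](mulKmx gram_unit) gk mulmxN linearN/= mulmxA.
  by rewrite mxtrace_mulC mulKVmx ?gram_unit// mxtrace_tr.
by move/eqP; rewrite -addr_eq0 -mulr2n mulrn_eq0/= => /eqP.
Qed.

Lemma mxtrace_theta Z : \tr (theta Z) = 0.
Proof.
have /eqP := mxtrace_tr (theta Z); rewrite tr_theta linearN/= eq_sym.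
by rewrite -addr_eq0 -mulr2n mulrn_eq0/= => /eqP.
Qed.

Let H := Hvec la.
Let a := ad la H.
Let b := ursubmx (ad mu (inp q H)).

(** [kappa] and [theta] are traceless, so the k-part of [W] contributes nothing; for the p-part the
    upper left block is 0 and the lower right one is [ad la]. *)
Lemma mxtrace_ad_Hvec W : \tr (ad mu W) = dotv H (prp W).
Proof.
have adD X Y : ad mu (X + Y) = ad mu X + ad mu Y.
  by have := ad_linear mus 1 X Y; rewrite !scale1r.
rewrite {1}(col_ink_inp W) adD linearD /= ad_ink mxtrace_block.
rewrite mxtrace_kappa mxtrace_theta addr0 add0r HvecP//.
rewrite -[ad mu _]submxK mxtrace_block ulsubmx_ad_inp drsubmx_ad_inp//.
by rewrite mxtrace0 add0r.
Qed.

(** By Jacobi, [ad mu] of a bracket is a commutator, hence traceless. *)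
Lemma dotv_Hvec_bracket W W' : dotv H (prp (mu W W')) = 0.
Proof.
by rewrite -mxtrace_ad_Hvec ad_jacobi// linearB/= mxtrace_mulC subrr.
Qed.

(** Skewness of the isotropy action moves [Z] to the other argument, where H is paired with a
    bracket. *)
Lemma isotropy_Hvec Z : mu (ink n Z) (inp q H) = 0.
Proof.
rewrite ad_block_inp// ad_ink block_mxKur block_mxKdr mul0mx.
suff -> : theta Z *m H = 0 by rewrite col_mx0.
by apply: dotv_inj => Y; rewrite theta_mul mu3 dotv_Hvec_bracket oppr0.
Qed.

Lemma ad_Hvec : ad mu (inp q H) = block_mx 0 b 0 a.
Proof.
rewrite -[LHS]submxK ulsubmx_ad_inp drsubmx_ad_inp//; congr block_mx.
apply: mulmx_injr => Z; rewrite mul0mx.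
have := isotropy_Hvec Z; rewrite bracketC// => /eqP.
by rewrite oppr_eq0 ad_block_ink// -col_mx0 => /eqP/eq_col_mx[].
Qed.

(** This is the p-component of the Jacobi identity for H, X, Y. The right-hand side comes from the
    k-components [b *m X] and [b *m Y] of the brackets with H, which [la] does not see. *)
Lemma delta_ad_Hvec X Y :
  delta la a X Y = theta (b *m Y) *m X - theta (b *m X) *m Y.
Proof.
have br W : mu (inp q H) (inp q W) = ink n (b *m W) + inp q (a *m W).
  by rewrite ad_block_inp// ad_Hvec block_mxKur block_mxKdr add_col_mx addr0
    add0r.
have brk W : mu (inp q H) (ink n W) = 0.
  by rewrite bracketC// isotropy_Hvec oppr0.
have inner V W : prp (mu (inp q V) (mu (inp q H) (inp q W))) =
    la V (a *m W) - theta (b *m W) *m V.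
  rewrite br bracketDr// prpD (bracketC (la := mu) _ (ink n _))// prpN addrC.
  by rewrite -theta_mul.
(* The k-component of the inner bracket drops out because H commutes with k. *)
have outer : prp (mu (inp q H) (mu (inp q X) (inp q Y))) = a *m la X Y.
  rewrite (col_ink_inp (mu (inp q X) _)) bracketDr// brk add0r br.
  by rewrite prpD prp_ink prp_inp add0r.
have := congr1 (@prp R q n) (muj (inp q H) (inp q X) (inp q Y)).
rewrite (bracketC (la := mu) (inp q Y) (inp q H))// bracketNr// !prpD prpN.
rewrite !inner outer (bracketC (la := la) Y)// deltaE => e.
move: e; rewrite [prp 0]linear0.
move: (la X (a *m Y)) (la (a *m X) Y) (a *m la X Y) => u v w.
move: (theta _ *m X) (theta _ *m Y) => x y e.
by rewrite -[RHS]subr0 -e; apply/colP => i; rewrite !mxE; ring.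
Qed.

(** M contributes -1/2 |a|^2, since H is orthogonal to all brackets; B contributes tr a^2, through
    the p-block alone; the last term vanishes because [a *m H] is 0. The sum is then read through
    [mxtrace_symp_sqr]. *)
Lemma dotv_Ric_Hvec : dotv (Ric mu *m H) H = - \tr (symp a *m symp a).
Proof.
have aH : a *m H = 0 by rewrite -skew_bilinear_adE// bracket_diag.
have MH : dotv (Mop la *m H) H = - 2^-1 * dotM a a.
  rewrite MopP// Mform_diag// [X in _ + _ * X]big1 ?mulr0 ?addr0// => i _.
  by rewrite big1// => j _; rewrite dotvC dotv_Hvec_bracket expr0n.
have BH : dotv (Bop mu *m H) H = \tr (a *m a).
  rewrite BopP// ad_Hvec mulmx_block mxtrace_block.
  by rewrite !(mul0mx, mulmx0, add0r, mxtrace0).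
have UH : dotv (symp a *m H) H = 0.
  rewrite /symp -scalemxAl mulmxDl aH add0r dotvC.
  have := dotvDr H 2^-1 (a^T *m H) 0; rewrite addr0 dotv0r addr0 => ->.
  by rewrite -dotv_mulmxl aH dotvC dotv0r scaler0.
rewrite /Ric !mulmxBl dotvC !dotvDRr !dotvNr ![dotv H _]dotvC MH UH.
rewrite mxtrace_symp_sqr -scalemxAl dotvC.
have := dotvDr H 2^-1 (Bop mu *m H) 0; rewrite addr0 dotv0r addr0 => ->.
by rewrite dotvC BH /GRing.scale /=; field.
Qed.

(** The defect due to [b]: it enters tr (M a) with factor -1/2 and tr (B a) with factor -1, so it
    cancels in tr (Ric a). *)
Let s := \sum_i \tr (theta (b *m stdb R i) *m ad la (stdb R i)).

(** Both terms of [delta_ad_Hvec] contribute [s], being exchanged by swapping the indices and using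
    skew-symmetry of [la]; the moment map factor -1/4 then gives -1/2. *)
Lemma mxtrace_Mop_ad_Hvec : \tr (Mop la *m a) = - 2^-1 * s.
Proof.
have E : \sum_i \sum_j dotv (la (stdb R i) (stdb R j))
    (theta (b *m stdb R i) *m stdb R j) = - s.
  rewrite -sumrN; apply: eq_bigr => i _.
  rewrite mxtrace_mulC -[in RHS](opprK (theta _)).
  rewrite -tr_theta mulmxN linearN /= opprK -/(dotM _ _) dotM_dotv.
  by apply: eq_bigr => j _; rewrite -skew_bilinear_adE.
rewrite mxtrace_Mop_mul// /dotV.
under eq_bigr => i _ do
  under eq_bigr => j _ do rewrite delta_ad_Hvec dotvDRr dotvNr.
under eq_bigr => i _ do rewrite big_split/= sumrN.
rewrite big_split/= sumrN E exchange_big/=.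
under eq_bigr => i _ do under eq_bigr => j _ do
  rewrite bracketC// dotvC dotvNr dotvC.
under eq_bigr => i _ do rewrite sumrN.
by rewrite sumrN E; field.
Qed.

(** [a *m X] is the bracket of H and X minus its k-component [b *m X]. The bracket contributes a
    trace of the form tr ([A, C] C) = 0, and the k-component leaves only the p-block. *)
Lemma mxtrace_Bop_ad_Hvec : \tr (Bop mu *m a) = - s.
Proof.
rewrite mxtrace_dotv -sumrN; apply: eq_bigr => i _; rewrite -mulmxA BopP//.
have -> : inp q (a *m stdb R i) =
    mu (inp q H) (inp q (stdb R i)) - ink n (b *m stdb R i).
  rewrite ad_block_inp// ad_Hvec block_mxKur block_mxKdr /inp /ink.
  by rewrite opp_col_mx add_col_mx subrr subr0.
have adB X Y : ad mu (X - Y) = ad mu X - ad mu Y.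
  by have := ad_linear mus (-1) Y X; rewrite !scaleN1r ![- _ + _]addrC.
rewrite adB ad_jacobi// mulmxBl mxtraceB mxtrace_lie sub0r; congr (- _).
rewrite ad_ink -[X in _ *m X]submxK ulsubmx_ad_inp drsubmx_ad_inp//.
by rewrite mulmx_block mxtrace_block !(mul0mx, mulmx0, addr0, add0r, mxtrace0).
Qed.

Lemma mxtrace_Ric_ad_Hvec : \tr (Ric mu *m a) = - \tr (symp a *m symp a).
Proof.
rewrite /Ric !mulmxBl !mxtraceB -scalemxAl mxtraceZ mxtrace_Mop_ad_Hvec.
rewrite mxtrace_Bop_ad_Hvec -/a mxtrace_mul_symp ?tr_symp//; ring.
Qed.

End HomogeneousSpace.

(** * Evolution of M, H, U and B when the bracket moves by a symmetric operator *)

Section Evolution.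
Variables (R : realType) (t : R) (n : nat).

(** The product rule for [deltaT la la] gives a matrix plus its transpose, that is, 2 [Delta]; the
    factor -1/4 of the moment map makes it -1/2. *)
Lemma is_derive_Mop (la : R -> bracket R n) (E : 'M[R]_n) :
  (\near t, skew_bilinear (la t)) ->
  is_derive_bracket t la (delta (la t) E) ->
  is_derive t (1 : R) (fun s => Mop (la s)) (- (2^-1 *: Delta (la t) E)).
Proof.
move=> lask lad; have latsk := nbhs_singleton lask.
apply: (@near_eq_is_derive _ _ _
    ((- 4^-1) \*: (fun s => deltaT (la s) (la s)))).
  by apply: filterS lask => s ls; rewrite Mop_deltaT.
apply: is_derive_eq (is_deriveZ _ (is_derive_deltaT lad lad)) _.
rewrite [X in _ + X]deltaT_tr//; last exact: skew_delta.
by rewrite /Delta /symp scalerA scaleNr; congr (- (_ *: _)); field.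
Qed.

Lemma is_derive_Hvec_delta (la : R -> bracket R n) (E : 'M[R]_n) :
  skew_bilinear (la t) -> E^T = E ->
  is_derive_bracket t la (delta (la t) E) ->
  is_derive t (1 : R) (fun s => Hvec (la s)) (E *m Hvec (la t)).
Proof.
move=> las Es lad; apply: is_derive_eq (is_derive_Hvec lad) _.
apply/colP => i; rewrite mxE mxtrace_ad_delta// -HvecP// -dotv_stdb.
by rewrite dotv_mulmxl Es.
Qed.

(** The term [ad (E H)] arises twice, from the motion of the bracket and from that of H, hence the
    factor 2. *)
Lemma is_derive_symp_ad_Hvec (la : R -> bracket R n) (E : 'M[R]_n) :
  (\near t, skew_bilinear (la t)) -> E^T = E ->
  is_derive_bracket t la (delta (la t) E) ->
  let H := Hvec (la t) in let adH := ad (la t) H in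
  is_derive t (1 : R) (fun s => symp (ad (la s) (Hvec (la s))))
    (2 *: symp (ad (la t) (E *m H)) + symp (adH *m E - E *m adH)).
Proof.
move=> lask Es lad H adH; have latsk := nbhs_singleton lask.
have dH := is_derive_Hvec_delta latsk Es lad.
have dadH := is_derive_ad_curve lask (skew_delta E latsk) lad dH.
apply: is_derive_eq (is_derive_symp dadH) _.
rewrite ad_delta// -/H -/adH; move: (ad _ _) (adH *m E) (E *m adH) => A C D.
by apply/matrixP => i j; rewrite !mxE; field.
Qed.

Variable q : nat.

Lemma is_derive_mu_p (mu : R -> bracket R (q + n)) (E : 'M[R]_n) :
  is_derive_bracket t mu (delta (mu t) (ext0 q E)) ->
  is_derive_bracket t (fun s => mu_p (mu s)) (delta (mu_p (mu t)) E).
Proof.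
move=> mud X Y; rewrite -mu_p_delta; apply/is_derive_mxP => i j.
have /is_derive_mxP/(_ (rshift q i) j) := mud (inp q X) (inp q Y).
rewrite (_ : (fun _ => _) = (fun s => mu_p (mu s) X Y i j)); last first.
  by apply/funext => s; rewrite [in RHS]mxE.
by move=> d; apply: is_derive_eq d _; rewrite [in RHS]mxE.
Qed.

Lemma is_derive_Bop (mu : R -> bracket R (q + n)) (E : 'M[R]_n) :
  skew_bilinear (mu t) -> E^T = E ->
  is_derive_bracket t mu (delta (mu t) (ext0 q E)) ->
  is_derive t (1 : R) (fun s => Bop (mu s)) (Bop (mu t) *m E + E *m Bop (mu t)).
Proof.
move=> mus Es mud; apply/is_derive_mxP => i j.
rewrite (_ : (fun _ => _) = (fun s =>
    \tr (ad (mu s) (inp q (stdb R j)) *m ad (mu s) (inp q (stdb R i)))));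
  last first.
  by apply/funext => s; rewrite mxE.
have dad k := is_derive_ad (inp q (stdb R k)) mud.
apply: is_derive_eq (is_derive_mxtrace (is_derive_mulmx (dad j) (dad i))) _.
rewrite !ad_delta// !ext0_inp.
have -> : (Bop (mu t) *m E + E *m Bop (mu t)) i j =
    \tr (ad (mu t) (inp q (E *m stdb R j)) *m ad (mu t) (inp q (stdb R i))) +
    \tr (ad (mu t) (inp q (stdb R j)) *m ad (mu t) (inp q (E *m stdb R i))).
  rewrite mxE -!BopP// -[X in _ = _ + dotv _ (X *m _)]Es -dotv_mulmxl.
  by rewrite !mulmxA !dotv_stdb !mulmx_stdb.
move: (ad _ (inp q (stdb R i))) (ad _ (inp q (stdb R j))) => Di Dj.
move: (ad _ (inp q (E *m stdb R i))) (ad _ (inp q (E *m stdb R j))) => Ei Ej.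
move: (ext0 q E) => F.
rewrite mulmxBl mulmxDl mulmxBr mulmxDr !mulmxA.
rewrite mxtraceD !mxtraceB !mxtraceD.
(* The terms containing [F] cancel by cyclicity of the trace. *)
by rewrite -[F *m Dj *m Di]mulmxA [\tr (F *m _)]mxtrace_mulC; ring.
Qed.

End Evolution.

(** * The nine evolution equations along the bracket flow *)

Theorem proposition3p8 (R : realType) (q n : nat) (I : set R)
    (mu : R -> bracket R (q + n)) (mu0 : bracket R (q + n)) :
  open I -> is_interval I -> I 0 ->
  Hqn mu0 -> mu 0 = mu0 ->
  (forall t, I t -> Hqn (mu t)) ->
  bracket_flow I mu ->
  forall t, I t ->
  let mupt := mu_p (mu t) in
  let Rc := Ric (mu t) in
  let M := Mop mupt in
  let B := Bop (mu t) in
  let H := Hvec mupt in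
  let adH := ad mupt H in
  (* (i) *)
  is_derive t (1 : R) (fun s => Ric (mu s))
    (- (2^-1 *: Delta mupt Rc) - 2^-1 *: (B *m Rc + Rc *m B)
     - 2 *: symp (ad mupt (Rc *m H)) - symp (adH *m Rc - Rc *m adH)) /\
  (* (ii) *)
  is_derive t (1 : R) (fun s => Mop (mu_p (mu s)))
    (- (2^-1 *: Delta mupt Rc)) /\
  (* (iii) *)
  is_derive t (1 : R) (fun s => Bop (mu s)) (B *m Rc + Rc *m B) /\
  (* (iv) *)
  is_derive t (1 : R) (fun s => Hvec (mu_p (mu s))) (Rc *m H) /\
  (* (v) *)
  is_derive t (1 : R) (fun s => symp (ad (mu_p (mu s)) (Hvec (mu_p (mu s)))))
    (2 *: symp (ad mupt (Rc *m H)) + symp (adH *m Rc - Rc *m adH)) /\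
  (* (vi) *)
  (is_derive t (1 : R) (fun s => \tr (Ric (mu s))) (2 * \tr (Rc *m Rc)) /\
   2 * \tr (Rc *m Rc) = 2 * dotM Rc Rc) /\
  (* (vii) *)
  is_derive t (1 : R) (fun s => dotV (mu_p (mu s)) (mu_p (mu s)))
    (- (8 * \tr (Rc *m M))) /\
  (* (viii) *)
  is_derive t (1 : R) (fun s => \tr (Bop (mu s))) (2 * \tr (Rc *m B)) /\
  (* (ix) *)
  is_derive t (1 : R) (fun s => dotv (Hvec (mu_p (mu s))) (Hvec (mu_p (mu s))))
    (- (2 * \tr (symp adH *m symp adH))).
Proof.
move=> Io _ _ _ _ muH flow t It mupt Rc M B H adH.
have [mus [mu1 _ mu3 mu4]] := muH t It.
have las : skew_bilinear mupt := skew_mu_p mus.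
have Rcs : Rc^T = Rc := tr_Ric mus.
(* The derivatives of M and U rest on identities for skew brackets, used on a whole neighbourhood of
   [t]; openness of [I] supplies it. *)
have lask : \near t, skew_bilinear (mu_p (mu t)).
  apply: filterS (open_nbhs_nbhs (conj Io It)) => s Is.
  by apply: skew_mu_p; case: (muH s Is).
have mud : is_derive_bracket t mu (delta (mu t) (ext0 q Rc)) by exact: flow.
have lad := is_derive_mu_p mud.
have dM := is_derive_Mop lask lad.
have dB := is_derive_Bop mus Rcs mud.
have dH := is_derive_Hvec_delta las Rcs lad.
have dU := is_derive_symp_ad_Hvec lask Rcs lad.
have dRic : is_derive t (1 : R) (fun s => Ric (mu s))
    (- (2^-1 *: Delta mupt Rc) - 2^-1 *: (B *m Rc + Rc *m B)
     - 2 *: symp (ad mupt (Rc *m H)) - symp (adH *m Rc - Rc *m adH)).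
  apply: is_derive_eq (is_deriveB (is_deriveB dM (is_deriveZ 2^-1 dB)) dU) _.
  by rewrite opprD addrA.
have RcH := dotv_Ric_Hvec mus mu1 mu3 mu4.
have trRcH := mxtrace_Ric_ad_Hvec mus mu1 mu3 mu4.
have dotVE : dotV mupt (delta mupt Rc) = - (4 * \tr (Rc *m M)).
  by rewrite [\tr _]mxtrace_mulC mxtrace_Mop_mul//; field.
split=> //; split=> //; split=> //; split=> //; split=> //; split.
  split; last by rewrite /dotM Rcs.
  apply: is_derive_eq (is_derive_mxtrace dRic) _.
  (* The trace of (i) is 2 tr (M Ric) - tr (B Ric) - 2 <H, Ric H>; the two identities for H replace
     <H, Ric H> by tr (Ric ad H). *)
  rewrite !mxtraceB linearN /= [\tr (_ *: Delta _ _)]mxtraceZ mxtrace_Delta//.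
  rewrite [\tr (2 *: _)]mxtraceZ !mxtrace_symp mxtraceZ mxtraceD mxtraceB.
  rewrite [\tr (adH *m Rc)]mxtrace_mulC subrr subr0.
  rewrite [\tr (Rc *m B)]mxtrace_mulC -HvecP// dotvC RcH -trRcH.
  (* One factor is expanded by the definition of Ric; since Ric is symmetric, [symp adH] may be
     replaced by [adH] in the trace. *)
  have -> : \tr (Rc *m Rc) = \tr (Mop mupt *m Rc) - 2^-1 * \tr (B *m Rc)
      - \tr (Rc *m adH).
    have RcE : Rc = Mop mupt - 2^-1 *: B - symp adH by [].
    rewrite [X in \tr (X *m _) = _]RcE 2!mulmxBl 2!mxtraceB -scalemxAl mxtraceZ.
    by rewrite [\tr (symp _ *m _)]mxtrace_mulC mxtrace_mul_symp.
  by field.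
split.
  apply: is_derive_eq (is_derive_dotV lad lad) _.
  by rewrite dotVC -/mupt dotVE; ring.
split.
  apply: is_derive_eq (is_derive_mxtrace dB) _.
  by rewrite mxtraceD mxtrace_mulC -/Rc; ring.
apply: is_derive_eq (is_derive_dotv dH dH) _.
by rewrite [X in _ + X]dotvC RcH; ring.
Qed.
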